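(* Let $(M^{2m},\varphi,g)$ be a para-Kähler-Norden manifold, $TM$ its tangent bundle equipped with the $\varphi$-Sasaki metric $g^\varphi$, and $F$ a $(1,1)$-tensor field on $M$. If $\Gamma=(\gamma(t),\xi(t))$ is a horizontal lift of a curve $\gamma$, then $\Gamma$ is an ${}^{H}F$-planar curve (resp., ${}^{H}F$-geodesic) if and only if $\gamma$ is an $F$-planar curve (resp., $F$-geodesic).
   Context: A para-Kähler-Norden manifold $(M^{2m},\varphi,g)$ is a $2m$-dimensional Riemannian manifold $(M,g)$ with a $(1,1)$-tensor field $\varphi$ such that $\varphi^2=\mathrm{id}$, $\varphi\ne\pm\mathrm{id}$, the $+1$ and $-1$ eigenbundles of $\varphi$ have equal rank, $g(\varphi X,Y)=g(X,\varphi Y)$, and $\nabla\varphi=0$, where $\nabla$ is the Levi-Civita connection of $g$. Points of $TM$ are written $(x,\xi)$; ${}^{H}X$, ${}^{V}X$ are the horizontal (with respect to $\nabla$) and vertical lifts to $TM$. The $\varphi$-Sasaki metric $g^\varphi$ on $TM$ is defined by $g^\varphi({}^HX,{}^HY)=g(X,Y)$, $g^\varphi({}^HX,{}^VY)=0$, $g^\varphi({}^VX,{}^VY)=g(X,\varphi Y)$; $\widetilde\nabla$ is its Levi-Civita connection. The horizontal lift ${}^HF$ of $F$ is the $(1,1)$-tensor field on $TM$ with ${}^HF({}^HX)={}^H(FX)$ and ${}^HF({}^VX)={}^V(FX)$. A curve $\Gamma=(\gamma(t),\xi(t))$ consists of a curve $\gamma$ on $M$ and a vector field $\xi$ along $\gamma$.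 Write $\gamma_t'=d\gamma/dt$, $\gamma_t''=\nabla_{\gamma_t'}\gamma_t'$, $\xi_t'=\nabla_{\gamma_t'}\xi$. $\Gamma$ is a horizontal lift of $\gamma$ if $\xi_t'=0$. $\gamma$ is $F$-planar if $\gamma_t''=\varrho_1\gamma_t'+\varrho_2F\gamma_t'$ for some functions $\varrho_1,\varrho_2$ of $t$, and an $F$-geodesic if $\gamma_t''=F\gamma_t'$. $\Gamma$ is ${}^HF$-planar if $\widetilde\nabla_{\Gamma_t'}\Gamma_t'=\varrho_1\Gamma_t'+\varrho_2\,{}^HF\,\Gamma_t'$ for some functions $\varrho_1,\varrho_2$ of $t$, and an ${}^HF$-geodesic if $\widetilde\nabla_{\Gamma_t'}\Gamma_t'={}^HF\,\Gamma_t'$. *)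

(* Defs.v *)
From HB Require Import structures.
From mathcomp Require Import all_boot all_order all_algebra.
From mathcomp Require Import all_classical all_reals all_analysis.
Set Implicit Arguments.
Unset Strict Implicit.
Unset Printing Implicit Defensive.
Import Order.TTheory GRing.Theory Num.Theory.
Import numFieldNormedType.Exports.
Local Open Scope classical_set_scope.
Local Open Scope ring_scope.

(* Tensor calculus on smooth manifolds in the classical style: a vector, a
   tensor or an affine connection is the family of its components in the charts
   of an atlas, subject to the usual transformation laws.  Vectors are row
   vectors, so that endomorphisms act on the right, as in [jacobian] and
   [eigenspace]. *)

Section Smooth.
Context {R : realType} {V W : normedModType R}.

Fixpoint Ck (k : nat) (U : set V) (f : V -> W) : Prop :=
  match k with
  | 0 => forall x, U x -> {for x, continuous f}
  | k'.+1 => (forall x, U x -> differentiable f x) /\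
             (forall v, Ck k' U ('D_v f))
  end.

Definition smooth_on (U : set V) (f : V -> W) : Prop := forall k, Ck k U f.

End Smooth.

(* Only the part of [crd i] on [dom i] is relevant. *)
Record atlas (R : realType) (n : nat) (X : Type) := Atlas {
  chart : Type;
  dom : chart -> set X;
  crd : chart -> X -> 'rV[R]_n }.

Section Atlas.
Context {R : realType} {n : nat} {X : Type}.
Variable A : atlas R n X.
Implicit Types (i j : chart A) (p q : X).

(* Inverse of the chart [i]; the point [p] is a default value used outside
   the image of the chart. *)
Definition chart_inv i p (u : 'rV[R]_n) : X :=
  if pselect (exists2 q, dom i q & crd i q = u) is left h
  then sval (cid2 h) else p.

Definition chart_img i : set 'rV[R]_n := crd i @` dom i.

(* [jac i j p] has entries d y^b / d x^a (row a, column b), where x and y are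
   the coordinates of the charts [i] and [j]. *)
Definition jac i j p : 'M[R]_n :=
  jacobian (fun u => crd j (chart_inv i p u)) (crd i p).

Definition pderiv {W : normedModType R} i (k : 'I_n) (f : X -> W) p : W :=
  'D_(delta_mx 0 k) (fun u => f (chart_inv i p u)) (crd i p).

Definition smooth_in_chart {W : normedModType R} i (f : X -> W) : Prop :=
  forall p, dom i p -> smooth_on (chart_img i) (fun u => f (chart_inv i p u)).

Definition bil (B : 'M[R]_n) (x y : 'rV[R]_n) : R := (x *m B *m y^T) 0 0.

(* Components of a tensor field of type (0,2) or (1,1): [t i p] is the matrix
   at the point [p] in the chart [i]. *)
Definition components := chart A -> X -> 'M[R]_n.

Record is_tensor02 (g : components) : Prop := {
  tensor02_law : forall i j p, dom i p -> dom j p ->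
    g i p = jac i j p *m g j p *m (jac i j p)^T;
  tensor02_smooth : forall i, smooth_in_chart i (g i) }.

Record is_tensor11 (F : components) : Prop := {
  tensor11_law : forall i j p, dom i p -> dom j p ->
    F i p *m jac i j p = jac i j p *m F j p;
  tensor11_smooth : forall i, smooth_in_chart i (F i) }.

Definition symmetric02 (g : components) : Prop :=
  forall i p, dom i p -> forall x y, bil (g i p) x y = bil (g i p) y x.

Definition positive_definite (g : components) : Prop :=
  forall i p, dom i p -> forall x, x != 0 -> 0 < bil (g i p) x x.

(* The entry (a, c) of [nabla i p k] is the Christoffel symbol Gamma^c_{ka}:
   nabla_{d_k} d_a = \sum_c Gamma^c_{ka} d_c. *)
Definition christoffel := chart A -> X -> 'I_n -> 'M[R]_n.

(* Row a of the matrix is nabla_x d_a, hence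
   nabla_x Y = x(Y) + Y *m conn_form nabla i p x. *)
Definition conn_form (nabla : christoffel) i p (x : 'rV[R]_n) : 'M[R]_n :=
  \sum_k x 0 k *: nabla i p k.

Record is_connection (nabla : christoffel) : Prop := {
  connection_law : forall i j p k, dom i p -> dom j p ->
    nabla i p k *m jac i j p =
      pderiv i k (jac i j) p
      + jac i j p *m conn_form nabla j p (row k (jac i j p));
  connection_smooth : forall i k,
    smooth_in_chart i (fun p => nabla i p k) }.

Definition torsion_free (nabla : christoffel) : Prop :=
  forall i p, dom i p ->
    forall k a c, nabla i p k a c = nabla i p a k c.

Definition cov02 (nabla : christoffel) (g : components) i p k : 'M[R]_n :=
  pderiv i k (g i) p - nabla i p k *m g i p - g i p *m (nabla i p k)^T.

Definition cov11 (nabla : christoffel) (F : components) i p k : 'M[R]_n :=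
  pderiv i k (F i) p + F i p *m nabla i p k - nabla i p k *m F i p.

Record levi_civita (g : components) (nabla : christoffel) : Prop := {
  levi_civita_connection : is_connection nabla;
  levi_civita_torsion_free : torsion_free nabla;
  levi_civita_metric : forall i p k, dom i p -> cov02 nabla g i p k = 0 }.

Definition smooth_curve (I : set R) (c : R -> X) : Prop :=
  forall i, open (I `&` c @^-1` dom i) /\
            smooth_on (I `&` c @^-1` dom i) (fun t => crd i (c t)).

Definition velocity (c : R -> X) i (t : R) : 'rV[R]_n :=
  derive1 (fun s => crd i (c s)) t.

(* nabla_{c'} Y for a vector field Y along c, given by its components. *)
Definition cov_along (nabla : christoffel) (c : R -> X)
    (Y : chart A -> R -> 'rV[R]_n) i (t : R) : 'rV[R]_n :=
  derive1 (Y i) t + Y i t *m conn_form nabla i (c t) (velocity c i t).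

Definition acceleration (nabla : christoffel) (c : R -> X) i (t : R) :=
  cov_along nabla c (velocity c) i t.

Definition planar (nabla : christoffel) (F : components) (I : set R)
    (c : R -> X) : Prop :=
  exists rho1 rho2 : R -> R, forall t i, I t -> dom i (c t) ->
    acceleration nabla c i t =
      rho1 t *: velocity c i t + rho2 t *: (velocity c i t *m F i (c t)).

Definition geodesic (nabla : christoffel) (F : components) (I : set R)
    (c : R -> X) : Prop :=
  forall t i, I t -> dom i (c t) ->
    acceleration nabla c i t = velocity c i t *m F i (c t).

(* Components are set to 0 in the charts that do not contain [p], so that equal
   tangent vectors have equal components in all charts. *)
Record tangent (p : X) := Tangent {
  tcomp :> chart A -> 'rV[R]_n;
  tangent_law : forall i j, dom i p -> dom j p ->
    tcomp j = tcomp i *m jac i j p;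
  tangent_out : forall i, ~ dom i p -> tcomp i = 0 }.

Definition tangent_bundle : Type := {p : X & tangent p}.

Definition tangent_atlas : atlas R (n + n) tangent_bundle :=
  @Atlas R (n + n) tangent_bundle (chart A)
    (fun i => [set w | dom i (projT1 w)])
    (fun i w => row_mx (crd i (projT1 w)) (projT2 w i)).

Definition smooth_along (I : set R) (c : R -> X)
    (xi : forall t, tangent (c t)) : Prop :=
  forall i, smooth_on (I `&` c @^-1` dom i) (fun t => xi t i).

Definition bundle_curve (c : R -> X) (xi : forall t, tangent (c t)) (t : R) :
  tangent_bundle := existT _ (c t) (xi t).

Definition horizontal_lift_of (nabla : christoffel) (I : set R) (c : R -> X)
    (xi : forall t, tangent (c t)) : Prop :=
  forall t i, I t -> dom i (c t) ->
    cov_along nabla c (fun j s => xi s j) i t = 0.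

(* Components, in the chart induced by [i], of the horizontal and vertical
   lifts to the point [w] = (p, xi) of the vector with components [x] at p:
   (x^c, - Gamma^c_{ka} x^k xi^a) and (0, x^c). *)
Definition hlift (nabla : christoffel) i (w : tangent_bundle) (x : 'rV[R]_n) :
  'rV[R]_(n + n) :=
  row_mx x (- (projT2 w i *m conn_form nabla i (projT1 w) x)).

Definition vlift (x : 'rV[R]_n) : 'rV[R]_(n + n) := row_mx 0 x.

End Atlas.

Record smooth_manifold (R : realType) (n : nat) (M : topologicalType)
    (A : atlas R n M) : Prop := {
  manifold_hausdorff : hausdorff_space M;
  manifold_second_countable : @second_countable M;
  manifold_cover : forall p, exists i : chart A, dom i p;
  manifold_dom_open : forall i : chart A, open (dom i);
  manifold_crd_inj : forall (i : chart A) p q,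
    dom i p -> dom i q -> crd i p = crd i q -> p = q;
  manifold_crd_homeo : forall (i : chart A) (U : set M),
    U `<=` dom i -> (open U <-> open (crd i @` U));
  manifold_transition : forall (i j : chart A) p, dom i p -> dom j p ->
    smooth_on (crd i @` (dom i `&` dom j))
      (fun u => crd j (chart_inv i p u)) }.

Record riemannian_metric (R : realType) (n : nat) (X : Type)
    (A : atlas R n X) (g : components A) : Prop := {
  riemannian_tensor : is_tensor02 g;
  riemannian_sym : symmetric02 g;
  riemannian_pos : positive_definite g }.

Record para_kahler_norden (R : realType) (m : nat) (M : topologicalType)
    (A : atlas R m.*2 M) (phi g : components A) (nabla : christoffel A) :
    Prop := {
  pkn_manifold : smooth_manifold A;
  pkn_metric : riemannian_metric g;
  pkn_levi_civita : levi_civita g nabla;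
  pkn_tensor : is_tensor11 phi;
  pkn_involution : forall i p, dom i p -> phi i p *m phi i p = 1%:M;
  pkn_neq_id : ~ (forall i p, dom i p -> phi i p = 1%:M);
  pkn_neq_opp_id : ~ (forall i p, dom i p -> phi i p = - 1%:M);
  pkn_rank : forall i p, dom i p ->
    \rank (eigenspace (phi i p) 1) = \rank (eigenspace (phi i p) (-1));
  pkn_pure : forall i p, dom i p -> forall x y,
    bil (g i p) (x *m phi i p) y = bil (g i p) x (y *m phi i p);
  pkn_parallel : forall i p k, dom i p -> cov11 nabla phi i p k = 0 }.

Record phi_sasaki (R : realType) (n : nat) (X : Type) (A : atlas R n X)
    (nabla : christoffel A) (phi g : components A)
    (G : components (tangent_atlas A)) : Prop := {
  phi_sasaki_tensor : is_tensor02 G;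
  phi_sasaki_sym : symmetric02 G;
  phi_sasaki_hh : forall (i : chart A) (w : tangent_bundle A),
    dom i (projT1 w) -> forall x y,
    bil (G i w) (hlift nabla i w x) (hlift nabla i w y)
      = bil (g i (projT1 w)) x y;
  phi_sasaki_hv : forall (i : chart A) (w : tangent_bundle A),
    dom i (projT1 w) -> forall x y,
    bil (G i w) (hlift nabla i w x) (vlift y) = 0;
  phi_sasaki_vv : forall (i : chart A) (w : tangent_bundle A),
    dom i (projT1 w) -> forall x y,
    bil (G i w) (vlift x) (vlift y)
      = bil (g i (projT1 w)) x (y *m phi i (projT1 w)) }.

Record horizontal_lift11 (R : realType) (n : nat) (X : Type)
    (A : atlas R n X) (nabla : christoffel A) (F : components A)
    (HF : components (tangent_atlas A)) : Prop := {
  horizontal_lift11_tensor : is_tensor11 HF;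
  horizontal_lift11_h : forall (i : chart A) (w : tangent_bundle A),
    dom i (projT1 w) -> forall x,
    hlift nabla i w x *m HF i w = hlift nabla i w (x *m F i (projT1 w));
  horizontal_lift11_v : forall (i : chart A) (w : tangent_bundle A),
    dom i (projT1 w) -> forall x,
    vlift x *m HF i w = vlift (x *m F i (projT1 w)) }.

(* Main.v *)
(** Along a horizontal lift, the velocity and the acceleration of [Gamma] are
    the horizontal lifts of those of [gamma]; as horizontal lifting is injective and
    intertwines [F] with its lift, both equivalences follow pointwise.  For the
    acceleration, the quadratic term [V * conn V] of the phi-Sasaki connection at
    a horizontal vector [V] over [v] is computed by testing Koszul's formula
    against arbitrary vectors: in induced coordinates the metric is
    [g(a, a') + h(b + N a, b' + N a')] with [h(x, y) = g(x, phi y)], and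
    [b + N a] vanishes at [V], so that [h] is never differentiated. *)

Require Import Defs.
From HB Require Import structures.
From mathcomp Require Import all_boot all_order all_algebra.
From mathcomp Require Import ring.
From mathcomp Require Import all_classical all_reals all_analysis.
Set Implicit Arguments.
Unset Strict Implicit.
Unset Printing Implicit Defensive.
Import Order.TTheory GRing.Theory Num.Theory.
Import numFieldNormedType.Exports.
Local Open Scope classical_set_scope.
Local Open Scope ring_scope.

(** * Directional derivatives of matrix-valued functions *)

Section DirectionalDerivatives.
Context {R : realType} {V : normedModType R}.
Implicit Types (a v : V).

Lemma is_derive_mx m n (f : V -> 'M[R]_(m, n)) a v (df : 'M[R]_(m, n)) :
  (forall i j, is_derive a v (fun x => f x i j) (df i j)) -> is_derive a v f df.
Proof.
move=> fE; have fav : derivable f a v.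
  by apply/derivable_mxP => i j; apply: ex_derive.
apply: DeriveDef => //; apply/matrixP => i j.
by rewrite derive_mx// mxE; apply: derive_val.
Qed.

Lemma is_derive_entry m n (f : V -> 'M[R]_(m, n)) a v (df : 'M[R]_(m, n)) i j :
  is_derive a v f df -> is_derive a v (fun x => f x i j) (df i j).
Proof.
move=> [fav <-]; apply: DeriveDef; first by move/derivable_mxP: fav; apply.
by rewrite derive_mx// mxE.
Qed.

Lemma is_derive_mulmx m n p (f : V -> 'M[R]_(m, n)) (g : V -> 'M[R]_(n, p))
    a v df dg :
  is_derive a v f df -> is_derive a v g dg ->
  is_derive a v (fun x => f x *m g x) (df *m g a + f a *m dg).
Proof.
move=> fav gav; apply: is_derive_mx => i k.
have -> : (fun x => (f x *m g x) i k) =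
    \sum_j ((fun x => f x i j) * (fun x => g x j k)).
  by apply/funext => x; rewrite mxE fct_sumE.
have fE j := is_derive_entry i j fav; have gE j := is_derive_entry j k gav.
apply: is_derive_eq; rewrite !mxE -big_split/=; apply: eq_bigr => j _.
rewrite addrC; congr (_ + _); exact: mulrC.
Qed.

Lemma is_derive_trmx m n (f : V -> 'M[R]_(m, n)) a v (df : 'M[R]_(m, n)) :
  is_derive a v f df -> is_derive a v (fun x => (f x)^T) df^T.
Proof.
move=> fav; apply: is_derive_mx => i j; rewrite mxE.
have -> : (fun x => (f x)^T i j) = (fun x => f x j i).
  by apply/funext => x; rewrite mxE.
exact: is_derive_entry.
Qed.

Lemma is_derive_bil n (B : V -> 'M[R]_n) (x y : V -> 'rV[R]_n) a v dB dx dy :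
  is_derive a v B dB -> is_derive a v x dx -> is_derive a v y dy ->
  is_derive a v (fun t => bil (B t) (x t) (y t))
    (bil dB (x a) (y a) + bil (B a) dx (y a) + bil (B a) (x a) dy).
Proof.
move=> Bav xav yav; rewrite /bil.
have := is_derive_entry 0 0
  (is_derive_mulmx (is_derive_mulmx xav Bav) (is_derive_trmx yav)).
move=> /is_derive_eq; apply.
by rewrite mulmxDl mxE [X in X + _ = _]mxE [X in X + _ = _]addrC.
Qed.

Lemma is_derive_row_mx m n1 n2 (f : V -> 'M[R]_(m, n1)) (g : V -> 'M[R]_(m, n2))
    a v df dg :
  is_derive a v f df -> is_derive a v g dg ->
  is_derive a v (fun x => row_mx (f x) (g x)) (row_mx df dg).
Proof.
move=> fav gav; apply: is_derive_mx => i j; rewrite mxE.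
have -> : (fun x => row_mx (f x) (g x) i j) =
    (fun x => match fintype.split j with
              | inl j1 => f x i j1 | inr j2 => g x i j2 end).
  by apply/funext => x; rewrite mxE.
by case: (fintype.split j) => k; exact: is_derive_entry.
Qed.

(** By linearity the difference quotient is constant, equal to [f v], away from [h = 0]. *)
Lemma is_derive_linear (W : normedModType R) (f : {linear V -> W}) a v :
  is_derive a v f (f v).
Proof.
suff fE : (fun h : R => h^-1 *: (f (h *: v + a) - f a)) @ 0^' --> f v.
  by apply: DeriveDef; [apply/cvg_ex; exists (f v)|exact/cvg_lim].
apply: cvg_near_cst; near=> h.
have h0 : h != 0 by near: h; exact: nbhs_dnbhs_neq.
by rewrite linearP addrK scalerA mulVf// scale1r.
Unshelve. all: by end_near. Qed.

(** Both sides have the same difference quotient. With [l := lsubmx], this pulls functions on M back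
    to TM. *)
Lemma is_derive_comp_linear (U W : normedModType R) (l : {linear V -> U})
    (f : U -> W) a v df :
  is_derive (l a) (l v) f df -> is_derive a v (f \o l) df.
Proof.
move=> [fav <-].
have lE : (fun h : R => h^-1 *: ((f \o l) (h *: v + a) - (f \o l) a)) =
          (fun h : R => h^-1 *: (f (h *: l v + l a) - f (l a))).
  by apply/funext => h /=; rewrite linearP.
by apply: DeriveDef; rewrite /derivable /derive/= lE.
Qed.

Lemma is_derive_comp_diff (U W : normedModType R) (f : U -> W) (c : V -> U)
    a v dc :
  differentiable f (c a) -> differentiable c a -> is_derive a v c dc ->
  is_derive a v (f \o c) ('D_dc f (c a)).
Proof.
move=> fd cd [_ <-]; have fcd := differentiable_comp cd fd.
apply: DeriveDef; first exact: diff_derivable.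
by rewrite !deriveE// diff_comp.
Qed.

End DirectionalDerivatives.

(** * Calculus in a chart, up to Koszul's formula *)

Section Charts.
Context {R : realType} {n : nat} {X : Type} {A : atlas R n X}.
Implicit Types (i : chart A) (p : X).

Lemma chart_invK i p u : chart_img i u ->
  dom i (chart_inv i p u) /\ crd i (chart_inv i p u) = u.
Proof.
move=> [q iq qu]; rewrite /chart_inv; case: pselect => [h|[]]; last by exists q.
by case: (cid2 h).
Qed.

Lemma derive_pderiv (W : normedModType R) i p (f : X -> W) (x : 'rV[R]_n) :
  dom i p -> smooth_in_chart i f ->
  'D_x (fun u => f (chart_inv i p u)) (crd i p) =
  \sum_k x 0 k *: pderiv i k f p.
Proof.
move=> ip fi; have [fd _] := fi p ip 1%N.
have df : differentiable (fun u => f (chart_inv i p u)) (crd i p).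
  by apply: fd; exists p.
rewrite deriveE// [in LHS](row_sum_delta x) linear_sum; apply: eq_bigr => k _.
rewrite /pderiv deriveE//; exact: linearZ.
Qed.

Section Bil.
Implicit Types (B : 'M[R]_n) (x y z : 'rV[R]_n).

Lemma bilDm B B' x y : bil (B + B') x y = bil B x y + bil B' x y.
Proof. by rewrite /bil mulmxDr mulmxDl mxE. Qed.

Lemma bilDl B x y z : bil B (x + y) z = bil B x z + bil B y z.
Proof. by rewrite /bil !mulmxDl mxE. Qed.

Lemma bilDr B x y z : bil B x (y + z) = bil B x y + bil B x z.
Proof. by rewrite /bil raddfD mulmxDr mxE. Qed.

Lemma bilNl B x z : bil B (- x) z = - bil B x z.
Proof. by rewrite /bil !mulNmx mxE. Qed.

Lemma bil0l B z : bil B 0 z = 0.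
Proof. by rewrite /bil !mul0mx mxE. Qed.

Lemma bil0r B z : bil B z 0 = 0.
Proof. by rewrite /bil trmx0 !mulmx0 mxE. Qed.

Lemma bil_mulml B C x y : bil (C *m B) x y = bil B (x *m C) y.
Proof. by rewrite /bil !mulmxA. Qed.

Lemma bil_mulmr B C x y : bil (B *m C^T) x y = bil B x (y *m C).
Proof. by rewrite /bil trmx_mul !mulmxA. Qed.

End Bil.

Lemma conn_formC nabla i p x y : torsion_free nabla -> dom i p ->
  x *m conn_form nabla i p y = y *m conn_form nabla i p x.
Proof.
move=> tf ip; apply/rowP => c.
have E (z t : 'rV[R]_n) : (z *m conn_form nabla i p t) 0 c =
    \sum_a \sum_k z 0 a * (t 0 k * nabla i p k a c).
  rewrite !mxE; apply: eq_bigr => a _; rewrite summxE big_distrr.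
  by apply: eq_bigr => k _; rewrite mxE.
rewrite !E exchange_big; apply: eq_bigr => a _; apply: eq_bigr => k _.
by rewrite tf// mulrCA.
Qed.

(** Koszul's formula for fields with constant components, whose brackets vanish. Metric
    compatibility gives [dg y] in terms of the connection form; expanding leaves g(x, z ω(x))
    against half of twice g(x, x ω(z)), and these agree by torsion-freeness. *)
Lemma levi_civita_diag (g : components A) nabla i p x z :
  is_tensor02 g -> symmetric02 g -> levi_civita g nabla -> dom i p ->
  let dg y := 'D_y (fun u => g i (chart_inv i p u)) (crd i p) in
  bil (g i p) (x *m conn_form nabla i p x) z =
  bil (dg x) x z - 2^-1 * bil (dg z) x x.
Proof.
move=> [_ gs] gC [_ tf gm] ip dg.
have dgE y : dg y = conn_form nabla i p y *m g i p +
                    g i p *m (conn_form nabla i p y)^T.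
  rewrite /dg derive_pderiv// /conn_form mulmx_suml linear_sum mulmx_sumr.
  rewrite -big_split; apply: eq_bigr => k _.
  have := gm i p k ip; rewrite /cov02 -addrA -opprD => /subr0_eq ->.
  by rewrite scalerDr linearZ -scalemxAl -scalemxAr.
rewrite !dgE !bilDm !bil_mulmr !bil_mulml.
(* Symmetry of g makes the two terms of [bil (dg z) x x] equal, which absorbs the factor 1/2. *)
rewrite -(gC i p ip x (x *m conn_form nabla i p z)).
by rewrite (conn_formC x z)//; field.
Qed.

End Charts.

(** * Jacobians of transition maps and the induced charts of TM *)

Section SmoothManifold.
Context {R : realType} {n : nat} {M : topologicalType} {A : atlas R n M}.
Hypothesis mA : smooth_manifold A.
Implicit Types (i j k : chart A) (p : M).

Lemma chart_inv_crd i p q : dom i q -> chart_inv i p (crd i q) = q.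
Proof.
move=> iq; have [iq' qE] : dom i (chart_inv i p (crd i q)) /\ _ :=
  chart_invK p (ex_intro2 _ _ q iq erefl).
exact: (manifold_crd_inj mA) qE.
Qed.

Lemma crd_openI i j : open (crd i @` (dom i `&` dom j)).
Proof.
apply/(manifold_crd_homeo mA); first by move=> x [].
by apply: openI; exact: manifold_dom_open mA _.
Qed.

Lemma open_chart_img i : open (chart_img i).
Proof. by rewrite /chart_img -[X in _ @` X]setIid; exact: crd_openI. Qed.

Lemma near_crd i j p : dom i p -> dom j p ->
  \forall u \near crd i p, (crd i @` (dom i `&` dom j)) u.
Proof.
by move=> ip jp; apply: open_nbhs_nbhs; split; [exact: crd_openI|exists p].
Qed.

Lemma transition_differentiable i j p : dom i p -> dom j p ->
  differentiable (fun u => crd j (chart_inv i p u)) (crd i p).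
Proof.
move=> ip jp; have [+ _] := manifold_transition mA ip jp 1%N.
by apply; exists p.
Qed.

Lemma mulmx_jac i j p v : dom i p -> dom j p ->
  v *m jac i j p = 'D_v (fun u => crd j (chart_inv i p u)) (crd i p).
Proof.
move=> ip jp; rewrite /jac deriveEjacobian//.
exact: transition_differentiable.
Qed.

Lemma jac_id i p : dom i p -> jac i i p = 1%:M.
Proof.
move=> ip; apply/row_matrixP => k; rewrite !rowE mulmx1 mulmx_jac//.
(* Off the chart image [chart_inv] returns its default point, so the map is the identity only near
   [crd i p]. *)
rewrite (@near_eq_derive _ _ _ _ id) ?derive_id//.
near=> u; have [q [iq _] <-] : (crd i @` (dom i `&` dom i)) u.
  by near: u; exact: near_crd.
by rewrite chart_inv_crd.
Unshelve. all: by end_near. Qed.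

(** The chain rule, row by row: [f \o c] agrees near [crd i p] with the transition map from [i] to
    [k]. *)
Lemma jac_mul i j k p : dom i p -> dom j p -> dom k p ->
  jac i j p *m jac j k p = jac i k p.
Proof.
move=> ip jp kp; apply/row_matrixP => l; rewrite !rowE mulmxA.
set v := delta_mx 0 l.
pose c u := crd j (chart_inv i p u); pose f u := crd k (chart_inv j p u).
have dc : differentiable c (crd i p) by exact: transition_differentiable.
have cE : c (crd i p) = crd j p by rewrite /c chart_inv_crd.
have df : differentiable f (c (crd i p)).
  by rewrite cE; exact: transition_differentiable.
have dcv := derivableP (@diff_derivable _ _ _ _ _ v dc).
apply: etrans (congr1 (mulmx^~ _) (mulmx_jac v ip jp)) _.
apply: etrans (mulmx_jac _ jp kp) _.
apply: etrans _ (esym (mulmx_jac v ip kp)).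
transitivity ('D_('D_v c (crd i p)) f (c (crd i p))); first by rewrite cE.
have [_ <-] := is_derive_comp_diff df dc dcv.
apply: near_eq_derive; near=> u.
have [q [iq jq] <-] : (crd i @` (dom i `&` dom j)) u.
  by near: u; exact: near_crd.
by rewrite /= /c /f !chart_inv_crd.
Unshelve. all: by end_near. Qed.

(** Transporting [eta] to every chart by the Jacobian is consistent by the cocycle rule [jac_mul];
    [jac_id] recovers [eta] in the chart [i]. *)
Lemma tangent_of_comp i p (eta : 'rV[R]_n) : dom i p ->
  exists x : tangent A p, x i = eta.
Proof.
move=> ip.
pose x j := if pselect (dom j p) then eta *m jac i j p else 0.
have xE j : dom j p -> x j = eta *m jac i j p by rewrite /x; case: pselect.
have xlaw j k : dom j p -> dom k p -> x k = x j *m jac j k p.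
  move=> jp kp; apply: etrans (xE k kp) _; apply/esym.
  apply: etrans (congr1 (mulmx^~ _) (xE j jp)) _.
  by apply: etrans (esym (mulmxA _ _ _)) _; congr mulmx; exact: jac_mul.
have xout j : ~ dom j p -> x j = 0 by rewrite /x; case: pselect.
exists (Tangent xlaw xout); apply: etrans (xE i ip) _.
by apply: etrans (congr1 (mulmx _) (jac_id ip)) _; exact: mulmx1.
Qed.

(** Every row vector is realised by a tangent vector, so the induced chart has image [chart_img i]
    times the whole fibre space, and its inverse splits into base and fibre coordinates. *)
Lemma tangent_chart_inv i (w : tangent_bundle A) (u : 'rV[R]_(n + n)) :
  chart_img i (lsubmx u) ->
  let w' := chart_inv (A := tangent_atlas A) i w u in
  [/\ dom i (projT1 w'), projT1 w' = chart_inv i (projT1 w) (lsubmx u)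
    & projT2 w' i = rsubmx u].
Proof.
move=> [q iq qu] w'; have [y yu] := tangent_of_comp (rsubmx u) iq.
have [iw'] : dom i (projT1 w') /\ row_mx (crd i (projT1 w')) (projT2 w' i) = u.
  apply: (chart_invK (A := tangent_atlas A)); exists (existT _ q y) => //=.
  by rewrite qu yu hsubmxK.
move=> w'u; split=> //; last by rewrite -w'u row_mxKr.
by rewrite -w'u row_mxKl chart_inv_crd.
Qed.

Lemma near_tangent_chart i p (x : 'rV[R]_n) : dom i p ->
  \forall u \near row_mx (crd i p) x, chart_img i (lsubmx u).
Proof.
move=> ip; apply: (@continuous_lsubmx R 1 n n (row_mx (crd i p) x)).
rewrite row_mxKl; apply: open_nbhs_nbhs.
by split; [exact: open_chart_img|exists p].
Qed.

End SmoothManifold.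

(** * Linearity and differentiation of the connection form *)

Section ConnectionDerivative.
Context {R : realType} {n : nat} {X : Type} {A : atlas R n X}.
Variable nabla : christoffel A.
Implicit Types (i : chart A) (p : X).

Lemma conn_formD i p x y :
  conn_form nabla i p (x + y) = conn_form nabla i p x + conn_form nabla i p y.
Proof.
by rewrite /conn_form -big_split; apply: eq_bigr => k _; rewrite mxE scalerDl.
Qed.

Lemma conn_formZ i p (r : R) x :
  conn_form nabla i p (r *: x) = r *: conn_form nabla i p x.
Proof.
by rewrite /conn_form scaler_sumr; apply: eq_bigr => k _; rewrite mxE scalerA.
Qed.

(** The derivative of the connection form in the direction [y], its argument [x] being frozen. *)
Definition conn_deriv i p (y x : 'rV[R]_n) : 'M[R]_n :=
  \sum_k x 0 k *:
    'D_y (fun u => nabla i (chart_inv i p u) k) (crd i p).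

(** The derivatives [dN] of the symbols along [q] are left abstract, so that [q] can be a chart
    inverse as well as the curve [gamma]. *)
Lemma is_derive_conn_form (V : normedModType R) (a v : V) i (q : V -> X)
    (x : V -> 'rV[R]_n) (dN : 'I_n -> 'M[R]_n) dx :
  (forall k, is_derive a v (fun t => nabla i (q t) k) (dN k)) ->
  is_derive a v x dx ->
  is_derive a v (fun t => conn_form nabla i (q t) (x t))
    (conn_form nabla i (q a) dx + \sum_k x a 0 k *: dN k).
Proof.
move=> qN xav; apply: is_derive_mx => b c.
have -> : (fun t => conn_form nabla i (q t) (x t) b c) =
    \sum_k ((fun t => x t 0 k) * (fun t => nabla i (q t) k b c)).
  apply/funext => t; rewrite fct_sumE summxE.
  by apply: eq_bigr => k _; rewrite mxE.
have NE k := is_derive_entry b c (qN k); have xE k := is_derive_entry 0 k xav.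
apply: is_derive_eq; rewrite mxE !summxE -big_split; apply: eq_bigr => k _.
rewrite !mxE /= addrC; congr (_ + _); exact: mulrC.
Qed.

End ConnectionDerivative.

(** * The phi-Sasaki metric in coordinates and its connection on horizontal vectors *)

Section Sasaki.
Context {R : realType} {n : nat} {M : topologicalType} {A : atlas R n M}.
Context {phi g : components A} {nabla : christoffel A}.
Context {G : components (tangent_atlas A)}
  {nablaT : christoffel (tangent_atlas A)}.
Hypotheses (mA : smooth_manifold A) (rg : riemannian_metric g)
  (lc : levi_civita g nabla) (phiT : is_tensor11 phi)
  (phi2 : forall i p, dom i p -> phi i p *m phi i p = 1%:M)
  (sG : phi_sasaki nabla phi g G) (lcT : levi_civita G nablaT).
Implicit Types (i : chart A) (p : M) (w : tangent_bundle A).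

(** The matrix of h(x, y) = g(x, phi y); the transpose comes from the row-vector convention. *)
Definition twisted_metric i p : 'M[R]_n := g i p *m (phi i p)^T.

Lemma row_mxE_lifts i w x y :
  row_mx x y = hlift nabla i w x +
    vlift (y + projT2 w i *m conn_form nabla i (projT1 w) x).
Proof. by rewrite /hlift /vlift add_row_mx addr0 addrCA addNr addr0. Qed.

Lemma sasakiE i w x y x' y' : dom i (projT1 w) ->
  bil (G i w) (row_mx x y) (row_mx x' y') =
  bil (g i (projT1 w)) x x' +
  bil (twisted_metric i (projT1 w))
    (y + projT2 w i *m conn_form nabla i (projT1 w) x)
    (y' + projT2 w i *m conn_form nabla i (projT1 w) x').
Proof.
move=> iw; rewrite !(row_mxE_lifts i w).
move: (y + _) (y' + _) => e e'; rewrite bilDl !bilDr bil_mulmr.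
rewrite (phi_sasaki_hh sG)// (phi_sasaki_hv sG)// (phi_sasaki_vv sG)//.
by rewrite (phi_sasaki_sym sG)// (phi_sasaki_hv sG)// addr0 add0r.
Qed.

(** The form h need not be definite, but its value on [e] and [e *m phi] is g(e, e) because phi
    squares to the identity. This kills the vertical part [e]; testing [z] against itself then
    leaves g(x, x). *)
Lemma sasaki_nondegenerate i w (z : 'rV[R]_(n + n)) : dom i (projT1 w) ->
  (forall z', bil (G i w) z z' = 0) -> z = 0.
Proof.
move=> iw; rewrite -[z]hsubmxK; set x := lsubmx z; set y := rsubmx z => z0.
have g0 t : bil (g i (projT1 w)) t t = 0 -> t = 0.
  by move=> t0; apply/eqP/negP => /negP/(riemannian_pos rg iw); rewrite t0 ltxx.
pose e := y + projT2 w i *m conn_form nabla i (projT1 w) x.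
have e0 : e = 0.
  apply: g0; have := z0 (row_mx 0 (e *m phi i (projT1 w))).
  rewrite sasakiE// bil0r add0r /twisted_metric bil_mulmr.
  have -> : conn_form nabla i (projT1 w) 0 = 0.
    by rewrite -(scale0r 0) conn_formZ scale0r.
  by rewrite mulmx0 addr0 -mulmxA phi2// mulmx1.
have x0 : x = 0.
  by apply: g0; have := z0 (row_mx x y); rewrite sasakiE// -/e e0 bil0l addr0.
move: e0; rewrite /e x0 -(scale0r 0) conn_formZ !scale0r mulmx0 addr0 => ->.
by rewrite row_mx0.
Qed.

Lemma smooth_in_chart_derivable (W : normedModType R) i p (f : M -> W) x :
  dom i p -> smooth_in_chart i f ->
  derivable (fun u => f (chart_inv i p u)) (crd i p) x.
Proof.
move=> ip fi; have [fd _] := fi p ip 1%N.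
by apply/diff_derivable/fd; exists p.
Qed.

Lemma is_derive_chart_conn i p x y : dom i p ->
  is_derive (crd i p) y (fun u => conn_form nabla i (chart_inv i p u) x)
    (conn_deriv nabla i p y x).
Proof.
move=> ip; apply: is_derive_eq.
  apply: (is_derive_conn_form (x := cst x)) (is_derive_cst _ _ _).
  move=> k; apply: derivableP.
  apply: (smooth_in_chart_derivable (f := fun q => nabla i q k)) => //.
  exact: (connection_smooth (levi_civita_connection lc)).
by rewrite -(scale0r 0) conn_formZ scale0r add0r.
Qed.

Definition dmetricT i w (Y : 'rV[R]_(n + n)) : 'M[R]_(n + n) :=
  'D_Y (fun u => G i (chart_inv (A := tangent_atlas A) i w u))
    (row_mx (crd i (projT1 w)) (projT2 w i)).

(** Differentiate [sasakiE] with the components of both vectors frozen at [w]. The first slot of h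
    vanishes at [w], so in the product rule for h only the term differentiating that slot
    survives. *)
Lemma bil_dmetricT i w v y e z c : dom i (projT1 w) ->
  let p := projT1 w in
  let xi := projT2 w i in
  bil (dmetricT i w (row_mx y e)) (hlift nabla i w v) (row_mx z c) =
  bil ('D_y (fun u => g i (chart_inv i p u)) (crd i p)) v z +
  bil (twisted_metric i p)
    (e *m conn_form nabla i p v + xi *m conn_deriv nabla i p y v)
    (c + xi *m conn_form nabla i p z).
Proof.
move=> iw p xi; set a := row_mx (crd i p) xi; set Y := row_mx y e.
pose b := - (xi *m conn_form nabla i p v).
pose cinv (u : 'rV[R]_(n + n)) : M := chart_inv i p (lsubmx u).
pose winv u := chart_inv (A := tangent_atlas A) i w u.
have GdY : is_derive a Y (fun u => bil (G i (winv u)) (row_mx v b) (row_mx z c))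
    (bil (dmetricT i w Y) (row_mx v b) (row_mx z c)).
  apply: is_derive_eq.
    apply: (is_derive_bil (x := cst (row_mx v b)) (y := cst (row_mx z c)) _
      (is_derive_cst _ _ _) (is_derive_cst _ _ _)).
    have iwT : dom (a := tangent_atlas A) i w by [].
    have [Gd _] := tensor02_smooth (phi_sasaki_tensor sG) iwT 1%N.
    by apply/derivableP/diff_derivable/Gd; exists w.
  by rewrite bil0l bil0r !addr0.
have nearE : \forall u \near a,
    bil (G i (winv u)) (row_mx v b) (row_mx z c) =
    bil (g i (cinv u)) v z + bil (twisted_metric i (cinv u))
      (b + rsubmx u *m conn_form nabla i (cinv u) v)
      (c + rsubmx u *m conn_form nabla i (cinv u) z).
  near=> u; have [|iu pu xu] := tangent_chart_inv mA (i := i) w (u := u).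
    by near: u; exact: near_tangent_chart.
  by rewrite sasakiE// xu pu.
have [_ <-] := near_eq_is_derive nearE GdY.
(* A function of the base point alone sees only the base part [y] of the direction [Y]. *)
have lE (W : normedModType R) (f : M -> W) df :
    is_derive (crd i p) y (fun u => f (chart_inv i p u)) df ->
    is_derive a Y (f \o cinv) df.
  move=> fd; apply: (is_derive_comp_linear (l := lsubmx)
    (f := fun u => f (chart_inv i p u))) => /=.
  by rewrite /a /Y !row_mxKl.
have gd : is_derive a Y (fun u => g i (cinv u))
    ('D_y (fun u => g i (chart_inv i p u)) (crd i p)).
  apply: (lE _ (g i)); apply/derivableP/smooth_in_chart_derivable => //.
  by case: (riemannian_tensor rg).
have pd : is_derive a Y (fun u => phi i (cinv u))
    ('D_y (fun u => phi i (chart_inv i p u)) (crd i p)).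
  apply: (lE _ (phi i)); apply/derivableP/smooth_in_chart_derivable => //.
  by case: phiT.
have hd := is_derive_mulmx gd (is_derive_trmx pd).
have ca : cinv a = p by rewrite /cinv row_mxKl chart_inv_crd.
have Nd x : is_derive a Y (fun u => rsubmx u *m conn_form nabla i (cinv u) x)
    (e *m conn_form nabla i p x + xi *m conn_deriv nabla i p y x).
  apply: is_derive_eq.
    apply: is_derive_mulmx; first exact: (is_derive_linear rsubmx).
    exact: (lE _ (fun q => conn_form nabla i q x))
      (is_derive_chart_conn _ _ iw).
  by rewrite /= ca /Y /a !row_mxKr.
have sE t x : (cst t + (fun u => rsubmx u *m conn_form nabla i (cinv u) x)) a =
    t + xi *m conn_form nabla i p x.
  by rewrite -[LHS]/(t + rsubmx a *m conn_form nabla i (cinv a) x) ca row_mxKr.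
have cstd x : is_derive a Y (cst x : _ -> 'rV[R]_n) 0 by exact: is_derive_cst.
have := is_deriveD (is_derive_bil gd (cstd v) (cstd z))
  (is_derive_bil hd (is_deriveD (cstd b) (Nd v)) (is_deriveD (cstd c) (Nd z))).
(* Here [addNr] is the vanishing of the first slot of h at [w]. *)
move=> -[_ ->] /=; rewrite !sE ca addNr.
by rewrite !bil0l !bil0r !add0r !addr0.
Unshelve. all: by end_near. Qed.

(** Koszul's formula on TM, tested on (z, c), is Koszul's formula on M tested on z plus one h-term;
    nondegeneracy then determines both blocks. *)
Lemma sasaki_horizontal_spray i w v : dom i (projT1 w) ->
  let p := projT1 w in
  let xi := projT2 w i in
  let omega := conn_form nabla i p in
  let V := hlift nabla i w v in
  V *m conn_form nablaT i w V =
  row_mx (v *m omega v)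
    (- (xi *m omega v) *m omega v + xi *m conn_deriv nabla i p v v
     - xi *m omega (v *m omega v)).
Proof.
move=> iw p xi omega V; apply/eqP; rewrite -subr_eq0; apply/eqP.
apply: (sasaki_nondegenerate iw) => Z.
rewrite -[Z]hsubmxK; move: (lsubmx Z) (rsubmx Z) => z c; rewrite bilDl bilNl.
have -> := levi_civita_diag (A := tangent_atlas A) (i := i) V (row_mx z c)
  (phi_sasaki_tensor sG) (phi_sasaki_sym sG) lcT iw.
pose dg y := 'D_y (fun u => g i (chart_inv i p u)) (crd i p).
have E1 : bil (dmetricT i w V) V (row_mx z c) = bil (dg v) v z +
    bil (twisted_metric i p) (- (xi *m omega v) *m omega v +
      xi *m conn_deriv nabla i p v v) (c + xi *m omega z).
  exact: bil_dmetricT.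
(* With [V] in both arguments the second slot of h vanishes too, so only g contributes. *)
have E2 : bil (dmetricT i w (row_mx z c)) V V = bil (dg z) v v.
  apply: etrans (bil_dmetricT _ _ _ _ _ iw) _.
  by rewrite [X in bil (twisted_metric _ _) _ X]addNr bil0r addr0.
have E3 := levi_civita_diag v z
  (riemannian_tensor rg) (riemannian_sym rg) lc iw.
(* By [subrK], the last fibre term of the claimed value cancels the correction that [sasakiE] adds
   for its base block. *)
rewrite E1 E2 sasakiE// [X in _ - (_ + bil (twisted_metric _ _) X _)]subrK E3.
by rewrite -/(dg v) -/(dg z); ring.
Qed.

End Sasaki.

(** * Linearity and injectivity of the horizontal lift *)

Section HorizontalLifts.
Context {R : realType} {n : nat} {X : Type} {A : atlas R n X}.
Variable nabla : christoffel A.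
Implicit Types (i : chart A) (w : tangent_bundle A).

Lemma hliftD i w x y :
  hlift nabla i w (x + y) = hlift nabla i w x + hlift nabla i w y.
Proof. by rewrite /hlift conn_formD mulmxDr opprD -add_row_mx. Qed.

Lemma hliftZ i w (r : R) x : hlift nabla i w (r *: x) = r *: hlift nabla i w x.
Proof. by rewrite /hlift conn_formZ -scalemxAr -scalerN -scale_row_mx. Qed.

Lemma hlift_inj i w : injective (hlift nabla i w).
Proof. by move=> x y /eq_row_mx[]. Qed.

End HorizontalLifts.

(** * Velocity and acceleration of a horizontal curve in TM *)

Section HorizontalCurves.
Context {R : realType} {n : nat} {M : topologicalType} {A : atlas R n M}.
Context {phi g : components A} {nabla : christoffel A}.
Context {G : components (tangent_atlas A)}
  {nablaT : christoffel (tangent_atlas A)}.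
Hypotheses (mA : smooth_manifold A) (rg : riemannian_metric g)
  (lc : levi_civita g nabla) (phiT : is_tensor11 phi)
  (phi2 : forall i p, dom i p -> phi i p *m phi i p = 1%:M)
  (sG : phi_sasaki nabla phi g G) (lcT : levi_civita G nablaT).
Context {I : set R} {gamma : R -> M} {xi : forall t, tangent A (gamma t)}.
Hypotheses (gammaS : smooth_curve A I gamma) (xiS : smooth_along I xi)
  (xiH : horizontal_lift_of nabla I xi).
Implicit Types (i : chart A) (t : R).

Lemma velocity_derive i :
  velocity gamma i = 'D_1 (fun s => crd i (gamma s)).
Proof. by apply/funext => t; rewrite /velocity derive1E. Qed.

Lemma is_derive_crd i t : I t -> dom i (gamma t) ->
  is_derive t 1 (fun s => crd i (gamma s)) (velocity gamma i t).
Proof.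
move=> It it; have [_ /(_ 1%N)[cd _]] := gammaS i.
by rewrite velocity_derive; apply/derivableP/diff_derivable/cd.
Qed.

Lemma is_derive_velocity i t : I t -> dom i (gamma t) ->
  is_derive t 1 (velocity gamma i) (derive1 (velocity gamma i) t).
Proof.
(* Smoothness of order 2, in the direction [1], makes the first derivative differentiable. *)
move=> It it; have [_ /(_ 2%N)[_ /(_ 1)[cd _]]] := gammaS i.
by rewrite derive1E velocity_derive; apply/derivableP/diff_derivable/cd.
Qed.

(** The parallel transport equation, solved for the ordinary derivative; its right-hand side is the
    fibre block of [hlift]. *)
Lemma is_derive_along i t : I t -> dom i (gamma t) ->
  is_derive t 1 (fun s => xi s i)
    (- (xi t i *m conn_form nabla i (gamma t) (velocity gamma i t))).
Proof.
move=> It it; have [xd _] := xiS i 1%N.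
have /eqP := xiH It it; rewrite /cov_along addr_eq0 => /eqP <-.
by rewrite derive1E; apply/derivableP/diff_derivable/xd.
Qed.

Lemma velocity_horizontal i t : I t -> dom i (gamma t) ->
  velocity (A := tangent_atlas A) (bundle_curve xi) i t =
  hlift nabla i (bundle_curve xi t) (velocity gamma i t).
Proof.
move=> It it; rewrite {1}/velocity derive1E.
by have [_ ->] :=
  is_derive_row_mx (is_derive_crd It it) (is_derive_along It it).
Qed.

Lemma near_curve_dom i t : I t -> dom i (gamma t) ->
  \forall s \near t, I s /\ dom i (gamma s).
Proof.
by move=> It it; apply: open_nbhs_nbhs; split=> //; have [] := gammaS i.
Qed.

Lemma is_derive_conn_along i t : I t -> dom i (gamma t) ->
  let v := velocity gamma i t in
  is_derive t 1 (fun s => conn_form nabla i (gamma s) (velocity gamma i s))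
    (conn_form nabla i (gamma t) (derive1 (velocity gamma i) t) +
     conn_deriv nabla i (gamma t) v v).
Proof.
move=> It it v.
apply: is_derive_conn_form; last exact: is_derive_velocity.
move=> k; set p := gamma t.
(* Near [t] the symbols along [gamma] factor through the coordinates, so the chain rule applies in
   the chart. *)
have nearE : \forall s \near t,
    nabla i (chart_inv i p (crd i (gamma s))) k = nabla i (gamma s) k.
  near=> s; have [_ ids] : I s /\ dom i (gamma s).
    by near: s; exact: near_curve_dom.
  by rewrite chart_inv_crd.
apply: near_eq_is_derive nearE _.
apply: (is_derive_comp_diff (f := fun u => nabla i (chart_inv i p u) k)).
- have [fd _] := connection_smooth (levi_civita_connection lc) k it 1%N.
  by apply: fd; exists p.
- by have [_ /(_ 1%N)[cd _]] := gammaS i; exact: cd.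
- exact: is_derive_crd.
Unshelve. all: by end_near. Qed.

(** Differentiating the fibre block -ξ ω(v) gives terms in ω(v) ω(v) and in the derivative of ω that
    the spray cancels; what is left is -ξ ω(v' + v ω(v)), the fibre block of the lifted
    acceleration. *)
Lemma acceleration_horizontal i t : I t -> dom i (gamma t) ->
  acceleration (A := tangent_atlas A) nablaT (bundle_curve xi) i t =
  hlift nabla i (bundle_curve xi t) (acceleration nabla gamma i t).
Proof.
move=> It it; rewrite /acceleration /cov_along velocity_horizontal//.
rewrite (sasaki_horizontal_spray mA rg lc phiT phi2 sG lcT)//=.
set v := velocity gamma i t; set omega := conn_form nabla i (gamma t).
(* The formula for the velocity is needed on a neighbourhood of [t], since it gets
   differentiated. *)
have VE : \forall s \near t,
    row_mx (velocity gamma i s)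
      (- (xi s i *m conn_form nabla i (gamma s) (velocity gamma i s))) =
    velocity (A := tangent_atlas A) (bundle_curve xi) i s.
  near=> s; have [Is ids] : I s /\ dom i (gamma s).
    by near: s; exact: near_curve_dom.
  by rewrite velocity_horizontal.
have := is_derive_row_mx (is_derive_velocity It it) (is_deriveN
  (is_derive_mulmx (is_derive_along It it) (is_derive_conn_along It it))).
move=> /(near_eq_is_derive VE)[_]; rewrite -derive1E => ->.
rewrite -/v -/omega add_row_mx /hlift; congr row_mx.
rewrite conn_formD !mulmxDr -/omega; set a := (- _) *m _.
rewrite [projT2 (bundle_curve xi t)]/=; set b := _ *m omega _.
set c := _ *m conn_deriv _ _ _ _ _; set d := _ *m omega _.
move: a b c d => a b c d.
rewrite [b + c]addrC [a + (c + b)]addrA (opprD (a + c)).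
by rewrite addrACA addNr add0r opprD.
Unshelve. all: by end_near. Qed.

End HorizontalCurves.

Theorem theorem5p5 (R : realType) (m : nat) (M : topologicalType)
    (A : atlas R m.*2 M) (phi g : components A) (nabla : christoffel A)
    (F : components A)
    (gphi HF : components (tangent_atlas A))
    (nablaT : christoffel (tangent_atlas A))
    (I : set R) (gamma : R -> M) (xi : forall t, tangent A (gamma t)) :
  para_kahler_norden phi g nabla ->
  phi_sasaki nabla phi g gphi ->
  levi_civita gphi nablaT ->
  is_tensor11 F ->
  horizontal_lift11 nabla F HF ->
  open I -> is_interval I ->
  smooth_curve A I gamma -> smooth_along I xi ->
  horizontal_lift_of nabla I xi ->
  (planar nablaT HF I (bundle_curve xi) <-> planar nabla F I gamma) /\
  (geodesic nablaT HF I (bundle_curve xi) <-> geodesic nabla F I gamma).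
Proof.
move=> [mA rg lc phiT phi2 _ _ _ _ _] sG lcT _ hF _ _ gammaS xiS xiH.
have accE i t : I t -> dom i (gamma t) ->
    acceleration (A := tangent_atlas A) nablaT (bundle_curve xi) i t =
    hlift nabla i (bundle_curve xi t) (acceleration nabla gamma i t).
  exact: (acceleration_horizontal mA rg lc phiT phi2 sG lcT gammaS xiS xiH).
have velE i t : I t -> dom i (gamma t) ->
    velocity (A := tangent_atlas A) (bundle_curve xi) i t =
    hlift nabla i (bundle_curve xi t) (velocity gamma i t).
  exact: (velocity_horizontal gammaS xiS xiH).
have HFE i t (x : 'rV[R]_(m.*2)) : dom i (gamma t) ->
    hlift nabla i (bundle_curve xi t) x *m HF i (bundle_curve xi t) =
    hlift nabla i (bundle_curve xi t) (x *m F i (gamma t)).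
  by move=> it; exact: (horizontal_lift11_h hF).
(* The coefficients are the same on both sides, so one pair of functions witnesses planarity of both
   curves. *)
have planarE i t (r s : R) : I t -> dom i (gamma t) ->
    acceleration (A := tangent_atlas A) nablaT (bundle_curve xi) i t =
      r *: velocity (A := tangent_atlas A) (bundle_curve xi) i t +
      s *: (velocity (A := tangent_atlas A) (bundle_curve xi) i t *m
            HF i (bundle_curve xi t)) <->
    acceleration nabla gamma i t =
      r *: velocity gamma i t + s *: (velocity gamma i t *m F i (gamma t)).
  move=> It it; rewrite accE// velE// HFE// -!hliftZ -hliftD.
  by split=> [/hlift_inj|->].
split; split.
- by move=> [r [s E]]; exists r, s => t i It it; apply/planarE => //; exact: E.
- by move=> [r [s E]]; exists r, s => t i It it; apply/planarE => //; exact: E.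
- move=> E t i It it; apply: (@hlift_inj _ _ _ _ nabla i (bundle_curve xi t)).
  by rewrite -accE// -HFE// -velE//; exact: E.
- by move=> E t i It it; rewrite accE// velE// HFE// E.
Qed.
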